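(* Let $(X,G)$ be a dynamical system. The following are equivalent: (1) the dynamical system $(X,G)$ is tame; (2) $\beta(X,G)<\infty$; (3) for every $f\in E(X,G)$, $\beta(f)<w(X)^+$.
   Context: A dynamical system $(X,G)$ is a compact Hausdorff space $X$ with a topological group $G$ acting continuously on $X$ by homeomorphisms. $\mathcal U$ denotes the unique compatible uniformity of $X$, i.e. the set of all neighbourhoods of the diagonal in $X\times X$. The Ellis semigroup $E(X,G)$ is the closure of $\{x\mapsto gx: g\in G\}$ in $X^X$ with the product (pointwise convergence) topology. The weight $w(X)$ is the least cardinality of a basis of $X$, and $\kappa^+$ is the successor cardinal of $\kappa$. A function $f:X\to X$ is fragmented if for every non-empty closed $D\subseteq X$ and every $W\in\mathcal U$ there is an open $V\subseteq X$ with $D\cap V\neq\emptyset$ and $(f(a),f(b))\in W$ for all $a,b\in D\cap V$. $(X,G)$ is tame if every $f\in E(X,G)$ is fragmented. For $Y\subseteq X$ closed, $f:Y\to X$ (for maps with larger domain use the restriction) and $W\in\mathcal U$, let $(Y)'_{f,W}$ be the set of $y\in Y$ such that for every open neighbourhood $V$ of $y$ in $Y$ there are $v_1,v_2\in V$ with $(f(v_1),f(v_2))\notin W$; this is a closed set. Put $(Y)^0_{f,W}=Y$, $(Y)^{\alpha+1}_{f,W}=((Y)^{\alpha}_{f,W})'_{f,W}$ and $(Y)^{\gamma}_{f,W}=\bigcap_{\alpha<\gamma}(Y)^{\alpha}_{f,W}$ for limit ordinals $\gamma$. Then $\beta(f,W)=\sup\{\alpha\in\mathrm{Ord}: (Y)^\alpha_{f,W}\neq\emptyset\}$,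 and $\beta(f,W)=\infty$ if $(Y)^\alpha_{f,W}\ne\emptyset$ for all ordinals $\alpha$ ($\infty$ is larger than every ordinal). For $f:X\to X$, $\beta(f)=\sup_{W\in\mathcal U}\beta(f,W)$; and $\beta(X,G)=\sup_{f\in E(X,G)}\beta(f)$. *)

(* Defs.v *)
From HB Require Import structures.
From mathcomp Require Import all_boot.
From mathcomp Require Import all_classical wochoice topology.
Set Implicit Arguments.
Unset Strict Implicit.
Unset Printing Implicit Defensive.
Local Open Scope classical_set_scope.
Local Open Scope card_scope.

(* An ordinal is a well-ordered type, two isomorphic well-orders being the same
   ordinal; everything below is invariant under isomorphism. Since [eqType]
   contains all types of the universe in which topological spaces (and sets of
   sets of their points) live, there are ordinals of every cardinality that
   matters here. [Ord] is itself too large for [set Ord] to be well-typed, so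
   classes of ordinals are written as predicates. *)
Record Ord := MkOrd {
  ord_sort :> eqType ;
  ord_le : rel ord_sort ;
  ord_wo : well_order ord_le }.

Definition ord_lt (a : Ord) (x y : a) : bool := ord_le x y && (x != y).

(* a is isomorphic to an initial segment of b *)
Definition ole (a b : Ord) : Prop := exists f : a -> b,
  {mono f : x y / ord_le x y} /\
  forall x y, ord_lt y (f x) -> exists x', f x' = y.

(* a is isomorphic to a proper initial segment {y | y < z} of b *)
Definition olt (a b : Ord) : Prop := exists (f : a -> b) (z : b),
  {mono f : x y / ord_le x y} /\ forall y, ord_lt y z <-> exists x, f x = y.

Section OrdElements.
Variable a : Ord.
Implicit Types x y z : a.

Let wo : wo_chain (@ord_le a) predT.
Proof. by move=> A _; exact: (ord_wo (o := a)). Qed.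

Lemma ord_le_total x y : ord_le x y || ord_le y x.
Proof. exact: (wo_chainW wo). Qed.

Lemma ord_lexx x : ord_le x x.
Proof. by have := ord_le_total x x; rewrite orbb. Qed.

Lemma ord_le_anti x y : ord_le x y -> ord_le y x -> x = y.
Proof.
by move=> xy yx; apply: (wo_chain_antisymmetric wo) => //; rewrite xy yx.
Qed.

Lemma ord_least (P : a -> Prop) :
  (exists x, P x) -> exists x, P x /\ forall y, P y -> ord_le x y.
Proof.
case=> x Px; have [|z [[/asboolP Pz minz] _]] := @ord_wo a [pred y | `[< P y >]].
  by exists x; apply/asboolP.
by exists z; split=> // y Py; apply: minz; apply/asboolP.
Qed.

Lemma ord_ltNge x y : ord_lt x y = ~~ ord_le y x.
Proof.
rewrite /ord_lt; have /orP[xy|yx] := ord_le_total x y.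
  rewrite xy /=; apply/idP/idP; first by apply: contraNN => /(ord_le_anti xy)->.
  by apply: contraNN => /eqP->; exact: ord_lexx.
rewrite yx; apply/negbTE; rewrite negb_and negbK.
by case: (boolP (ord_le x y)) => //= /ord_le_anti/(_ yx)->.
Qed.

Lemma ord_le_trans x y z : ord_le x y -> ord_le y z -> ord_le x z.
Proof.
move=> xy yz.
have [w []] : exists w, (w = x \/ w = y \/ w = z) /\
    forall v, (v = x \/ v = y \/ v = z) -> ord_le w v.
  by apply: (@ord_least (fun w => w = x \/ w = y \/ w = z)); exists x; left.
move=> + minw; case=> [ew|[ew|ew]]; rewrite {}ew in minw.
- by apply: minw; auto.
- by rewrite (ord_le_anti xy (minw _ _)); auto.
- by rewrite -(ord_le_anti yz (minw _ _)); auto.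
Qed.

Lemma ord_ltxx x : ord_lt x x = false.
Proof. by rewrite /ord_lt eqxx andbF. Qed.

Lemma ord_ltW x y : ord_lt x y -> ord_le x y. Proof. by case/andP. Qed.

Lemma ord_lt_le_trans x y z : ord_lt x y -> ord_le y z -> ord_lt x z.
Proof.
rewrite !ord_ltNge => xy yz; apply: contraNN xy => zx.
exact: ord_le_trans zx.
Qed.

Lemma ord_lt_wf : well_founded (@ord_lt a).
Proof.
move=> x; apply: contrapT => nx.
have [y [ny miny]] := @ord_least (fun y => ~ Acc (@ord_lt a) y) (ex_intro _ x nx).
apply: ny; constructor=> z zy; apply: contrapT => /miny.
by apply/negP; rewrite -ord_ltNge.
Qed.

End OrdElements.

Section OrdMono.
Variables (a b : Ord) (f : a -> b).
Hypothesis fle : {mono f : x y / ord_le x y}.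

Lemma ord_lt_mono : {mono f : x y / ord_lt x y}.
Proof. by move=> x y; rewrite !ord_ltNge fle. Qed.

Lemma ord_mono_inj : injective f.
Proof.
by move=> x y fxy; apply: ord_le_anti; rewrite -fle fxy ord_lexx.
Qed.

End OrdMono.

Lemma ole_refl a : ole a a.
Proof. by exists id; split=> // x y _; exists y. Qed.

Lemma ole_trans a b c : ole a b -> ole b c -> ole a c.
Proof.
move=> [f [fle fi]] [g [gle gi]]; exists (g \o f); split.
  by move=> x y /=; rewrite gle fle.
move=> x y /= ygf; have [y' e] := gi _ _ ygf.
by move: ygf; rewrite -e (ord_lt_mono gle) => /fi[x' <-]; exists x'.
Qed.

Lemma oltW a b : olt a b -> ole a b.
Proof.
move=> [f [z [fle fi]]]; exists f; split=> // x y yx.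
apply/(fi y)/(ord_lt_le_trans yx)/ord_ltW.
by apply/fi; exists x.
Qed.

Lemma olt_ole_trans a b c : olt a b -> ole b c -> olt a c.
Proof.
move=> [f [z [fle fi]]] [g [gle gi]]; exists (g \o f), (g z); split.
  by move=> x y /=; rewrite gle fle.
move=> y; split=> [ygz|[x <-]]; last first.
  by rewrite (ord_lt_mono gle); apply/fi; exists x.
have [y' e] := gi _ _ ygz; move: ygz; rewrite -e (ord_lt_mono gle).
by move=> /fi[x <-]; exists x.
Qed.

Lemma olt_wf : well_founded olt.
Proof.
have acc_seg (b : Ord) (z : b) (a : Ord) (f : a -> b) :
    {mono f : x y / ord_le x y} -> (forall y, ord_lt y z <-> exists x, f x = y) ->
    Acc olt a.
  elim/(well_founded_ind (@ord_lt_wf b)): z a f => z IH a f fle fi.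
  constructor=> c [g [w [gle gi]]].
  apply: (IH (f w) _ c (f \o g)); first by apply/fi; exists w.
    by move=> x y /=; rewrite fle gle.
  move=> y; split=> [yfw|[x <-] /=]; last first.
    by rewrite (ord_lt_mono fle); apply/gi; exists x.
  have /fi[v e] : ord_lt y z.
    by apply: (ord_lt_le_trans yfw); apply: ord_ltW; apply/fi; exists w.
  by move: yfw; rewrite -e (ord_lt_mono fle) => /gi[x <-]; exists x.
by move=> b; constructor=> a [f [z [fle fi]]]; exact: acc_seg fle fi.
Qed.

Lemma olt_irrefl a : ~ olt a a.
Proof. by elim/(well_founded_ind olt_wf): a => a IH aa; exact: (IH a aa aa). Qed.

Lemma ole_total a b : ole a b \/ olt b a.
Proof.
pose E (x : a) (y : b) := exists h : a -> b,
  {in [pred u | ord_lt u x] &, {mono h : u v / ord_le u v}} /\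
  forall w, ord_lt w y <-> exists2 u, ord_lt u x & h u = w.
have E_lt x y x' y' : E x y -> E x' y' -> ord_lt x x' -> ord_lt y y'.
  move=> [h [hle hi]] [h' [h'le h'i]] xx'.
  have hh' u : ord_lt u x -> h u = h' u.
    elim/(well_founded_ind (@ord_lt_wf a)): u => u IH ux.
    have ux' : ord_lt u x' := ord_lt_le_trans ux (ord_ltW xx').
    apply: ord_le_anti; rewrite -[ord_le _ _]negbK -ord_ltNge; apply/negP => lt.
      have [v vx e] : exists2 v, ord_lt v x & h v = h' u.
        by apply/hi; apply: (ord_lt_le_trans lt); apply/ord_ltW/hi; exists u.
      have vu : ord_lt v u by move: lt; rewrite -e !ord_ltNge hle.
      have := IH v vu vx; rewrite e => /esym h'vu; move: vu.
      rewrite ord_ltNge -(h'le u v) ?h'vu ?ord_lexx //.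
      exact: ord_lt_le_trans vx (ord_ltW xx').
    have [v vx' e] : exists2 v, ord_lt v x' & h' v = h u.
      by apply/h'i; apply: (ord_lt_le_trans lt); apply/ord_ltW/h'i; exists u.
    have vu : ord_lt v u by move: lt; rewrite -e !ord_ltNge h'le.
    have vx := ord_lt_le_trans vu (ord_ltW ux).
    have := IH v vu vx; rewrite e => hvu; move: vu.
    by rewrite ord_ltNge -(hle u v) ?hvu ?ord_lexx.
  rewrite ord_ltNge; apply/negP => y'y.
  have /hi[u ux e] : ord_lt (h' x) y.
    by apply: ord_lt_le_trans y'y; apply/h'i; exists x.
  move: (e); rewrite hh' // => h'ux; move: (ux).
  rewrite ord_ltNge -(h'le x u) ?h'ux ?ord_lexx //.
  exact: ord_lt_le_trans ux (ord_ltW xx').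
have E_down x y w : E x y -> ord_lt w y -> exists2 u, ord_lt u x & E u w.
  move=> [h [hle hi]] wy; have [u ux hu] := (hi w).1 wy.
  exists u => //; exists h; split.
    move=> s t su tu; apply: hle; rewrite inE.
      exact: ord_lt_le_trans su (ord_ltW ux).
    exact: ord_lt_le_trans tu (ord_ltW ux).
  move=> v; split=> [vw|[s su <-]]; last first.
    rewrite -hu ord_ltNge hle -?ord_ltNge //.
    by rewrite inE; apply: ord_lt_le_trans su (ord_ltW ux).
  have [s sx hs] := (hi v).1 (ord_lt_le_trans vw (ord_ltW wy)).
  by exists s => //; move: vw; rewrite -hs -hu !ord_ltNge hle.
have E_mono x y x' y' : E x y -> E x' y' -> ord_le y y' = ord_le x x'.
  move=> Exy Exy'; apply/idP/idP; last first.
    move=> xx'; rewrite -[ord_le _ _]negbK -ord_ltNge; apply/negP => y'y.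
    have [u ux Eu] := E_down _ _ _ Exy y'y.
    by have := E_lt _ _ _ _ Eu Exy' (ord_lt_le_trans ux xx'); rewrite ord_ltxx.
  move=> yy'; rewrite -[ord_le _ _]negbK -ord_ltNge; apply/negP => /(E_lt _ _ _ _ Exy' Exy).
  by rewrite ord_ltNge yy'.
have [allE|nE] := pselect (forall x, exists y, E x y).
  left; pose g x := projT1 (cid (allE x)).
  have gE x : E x (g x) := projT2 (cid (allE x)).
  exists g; split=> [x y|x y /(E_down _ _ _ (gE x))[u _ Eu]]; first exact: E_mono.
  by exists u; apply: ord_le_anti; rewrite (E_mono _ _ _ _ (gE u) Eu, E_mono _ _ _ _ Eu (gE u)) ord_lexx.
right; have [x0 [nx0 minx0]] := ord_least ((existsNP _).2 nE).
have Ex x : ord_lt x x0 -> exists y, E x y.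
  by move=> lt; apply: contrapT => /minx0; apply/negP; rewrite -ord_ltNge.
have allE y : exists x, ord_lt x x0 /\ E x y.
  apply: contrapT => ny; apply: nx0.
  have [z [nz minz]] := @ord_least b (fun y => ~ exists x, ord_lt x x0 /\ E x y) (ex_intro _ y ny).
  have [g gE] : {g : a -> b & forall x, ord_lt x x0 -> E x (g x)}.
    apply: (choice (X:=a) (Y:=b) (P:=fun x y => ord_lt x x0 -> E x y)) => x.
    by have [/Ex[w]|] := pselect (ord_lt x x0); [exists w|exists y].
  exists z, g; split=> [u v ux vx|w]; first by apply: E_mono; exact: gE.
  split=> [wz|[u ux <-]].
    have [u [ux Eu]] : exists x, ord_lt x x0 /\ E x w.
      by apply: contrapT => /minz; apply/negP; rewrite -ord_ltNge.
    by exists u => //; apply: ord_le_anti;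
      rewrite (E_mono _ _ _ _ (gE u ux) Eu, E_mono _ _ _ _ Eu (gE u ux)) ord_lexx.
  rewrite ord_ltNge; apply/negP => zu; apply: nz.
  have [e|ne] := eqVneq z (g u); first by exists u; rewrite e; split=> //; exact: gE.
  have [|v vu Ev] := E_down _ _ z (gE u ux); first by rewrite /ord_lt zu.
  by exists v; split=> //; apply: ord_lt_le_trans vu (ord_ltW ux).
pose g y := projT1 (cid (allE y)).
have [gx gE] : (forall y, ord_lt (g y) x0) /\ (forall y, E (g y) y).
  by split=> y; have [] := projT2 (cid (allE y)).
exists g, x0; split=> [x y|x]; first by rewrite (E_mono _ _ _ _ (gE x) (gE y)).
split=> [/[dup] xx0 /Ex[y Exy]|[y <-]//].
by exists y; apply: ord_le_anti;
  rewrite -(E_mono _ _ _ _ (gE y) Exy, E_mono _ _ _ _ Exy (gE y)) ord_lexx.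
Qed.

Definition is_ordmin (P : Ord -> Prop) (a : Ord) : Prop :=
  P a /\ forall b, P b -> ole a b.

Lemma ordmin_exists (P : Ord -> Prop) : (exists a, P a) -> exists a, is_ordmin P a.
Proof.
case=> a; elim/(well_founded_ind olt_wf): a => a IH Pa.
have [[b [Pb /IH/(_ Pb)//]]|nlt] := pselect (exists b, P b /\ olt b a).
exists a; split=> // b Pb; have [//|ba] := ole_total a b.
by case: nlt; exists b.
Qed.

Lemma void_wo : well_order (fun _ _ : void => true).
Proof. by move=> A [[]]. Qed.

Definition ord0 : Ord := MkOrd void_wo.

(* The least ordinal satisfying P (0 when there is none) *)
Definition ordmin (P : Ord -> Prop) : Ord :=
  if pselect (exists a, is_ordmin P a) is left e then projT1 (cid e) else ord0.

Lemma ordminP (P : Ord -> Prop) : (exists a, P a) -> is_ordmin P (ordmin P).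
Proof.
by move=> /ordmin_exists Pe; rewrite /ordmin; case: pselect => // e; case: cid.
Qed.

(* The successor of the cardinal of k, as an initial ordinal: the least ordinal
   that does not inject into k. *)
Definition card_succ (k : Ord) : Ord :=
  ordmin (fun l : Ord => ~ ([set: l] #<= [set: k])).

(* Cardinals are initial ordinals: the least ordinal equipotent to some basis
   has the least cardinality of a basis. *)
Definition weight (X : topologicalType) : Ord :=
  ordmin (fun k : Ord => exists2 B : set (set X), basis B & [set: k] #= B).

Lemma card_ord (T : choiceType) (A : set T) : exists k : Ord, [set: k] #= A.
Proof.
have [R woR] := well_ordering_principle A.
exists (MkOrd woR); exact: card_setT.
Qed.

Lemma card_succP (k : Ord) :
  is_ordmin (fun l : Ord => ~ ([set: l] #<= [set: k])) (card_succ k).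
Proof.
apply: ordminP; have [R woR] := well_ordering_principle (set k).
exists (MkOrd woR) => /card_leP[f].
have [g ginj] : exists g : set k -> k, injective g.
  exists (fun A => val (f (to_setT A))) => A B /val_inj /(@inj _ _ _ f).
  by move=> /(_ (mem_set I) (mem_set I)) /(congr1 val).
pose D := [set x : k | exists2 A : set k, x = g A & ~ A x].
have nD : ~ D (g D) by move=> /[dup] Dg [A /ginj <-].
by apply: (nD); exists D.
Qed.

Lemma weightP (X : topologicalType) :
  is_ordmin (fun k : Ord => exists2 B : set (set X), basis B & [set: k] #= B)
            (weight X).
Proof.
apply: ordminP; have [k kX] := card_ord (@open X); exists k; exists open => //.
split=> // x A; rewrite nbhsE => -[U [oU Ux] UA].
by exists U.
Qed.

Inductive eOrd := EFin of Ord | EInf.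

Definition eole (u v : eOrd) : Prop :=
  match u, v with
  | EFin a, EFin b => ole a b
  | _, EInf => True
  | EInf, EFin _ => False
  end.

Definition eolt (u v : eOrd) : Prop :=
  match u, v with
  | EFin a, EFin b => olt a b
  | EFin _, EInf => True
  | EInf, _ => False
  end.

(* The least upper bound; it is infinite exactly when no ordinal is an upper
   bound, e.g. for the class of all ordinals. *)
Definition esup (S : eOrd -> Prop) : eOrd :=
  let ub (a : Ord) := forall u, S u -> eole u (EFin a) in
  if pselect (exists a, ub a) then EFin (ordmin ub) else EInf.

(* c is the greatest ordinal below a, i.e. a = c + 1 *)
Definition is_succ (c a : Ord) : Prop :=
  olt c a /\ forall d, olt d a -> ole d c.

Definition is_zero (a : Ord) : Prop := forall c, ~ olt c a.

Definition is_limit (a : Ord) : Prop := ~ is_zero a /\ forall c, ~ is_succ c a.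

(* The compatible uniformity of a compact Hausdorff space: the neighbourhoods
   of the diagonal *)
Definition unif (X : topologicalType) : set (set (X * X)) :=
  \bigcap_(p in @diagonal X) nbhs p.

Section Derivatives.
Variables (X : topologicalType) (f : X -> X) (W : set (X * X)).
Implicit Types Y : set X.

(* The open neighbourhoods of y in Y are the O `&` Y. *)
Definition deriv Y : set X :=
  [set y | Y y /\ forall O, open O -> O y ->
    exists v1 v2, [/\ (O `&` Y) v1, (O `&` Y) v2 & ~ W (f v1, f v2)]].

Definition deriv_iter_step Y (a : Ord) (D : forall c, olt c a -> set X) : set X :=
  [set y | [/\ is_zero a -> Y y,
               forall c (ca : olt c a), is_succ c a -> deriv (D c ca) y &
               is_limit a -> forall c (ca : olt c a), D c ca y]].

Definition deriv_iter Y : Ord -> set X :=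
  Fix olt_wf (fun=> set X) (@deriv_iter_step Y).

Lemma deriv_iterE Y a :
  deriv_iter Y a = deriv_iter_step Y (fun c (_ : olt c a) => deriv_iter Y c).
Proof.
rewrite /deriv_iter Fix_eq // => b D D' DD'.
suff -> : D = D' by [].
by apply: functional_extensionality_dep => c; apply: functional_extensionality_dep.
Qed.

Lemma deriv_iter0 Y a : is_zero a -> deriv_iter Y a = Y.
Proof.
move=> a0; rewrite deriv_iterE; apply/seteqP; split=> y; first by case=> /(_ a0).
by move=> Yy; split=> // [c /a0|[]].
Qed.

Lemma deriv_iter_succ Y c a :
  is_succ c a -> deriv_iter Y a = deriv (deriv_iter Y c).
Proof.
move=> ca; rewrite deriv_iterE; apply/seteqP; split=> y.
  by case=> _ /(_ c ca.1 ca).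
move=> Dy; split=> [/(_ c)/(_ ca.1)//|d da [_ dmax]|[_ /(_ c)]//].
suff -> : deriv_iter Y d = deriv_iter Y c by [].
have dc : ole d c := ca.2 d da.
have cd : ole c d := dmax c ca.1.
have lt e : olt e d <-> olt e c.
  by split=> /olt_ole_trans; [apply|apply].
have suc e : is_succ e d <-> is_succ e c.
  by split=> -[e1 e2]; split; [exact/lt|move=> g /lt/e2|exact/lt|move=> g /lt/e2].
have zer : is_zero d <-> is_zero c.
  by split=> z e /lt/z.
have lim : is_limit d <-> is_limit c.
  by split=> -[nz ns]; split; [move/zer|move=> e /suc/ns|move/zer|move=> e /suc/ns].
rewrite !deriv_iterE; apply/seteqP; split=> x [h0 hs hl]; split.
- by move/zer.
- by move=> e ec /suc/hs; apply; exact/lt.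
- by move=> /lim/hl{}hl e /lt/hl.
- by move/zer.
- by move=> e ec /suc/hs; apply; exact/lt.
- by move=> /lim/hl{}hl e /lt/hl.
Qed.

Lemma deriv_iter_limit Y a : is_limit a ->
  deriv_iter Y a = [set y | forall c, olt c a -> deriv_iter Y c y].
Proof.
move=> al; rewrite [LHS]deriv_iterE; apply/seteqP; split=> y.
  by case=> _ _ /(_ al).
by move=> Dy; split=> // [/al.1//|c _ /al.2].
Qed.

Definition beta_W Y : eOrd :=
  esup (fun u => exists2 a, u = EFin a & deriv_iter Y a !=set0).

End Derivatives.

Definition beta_map (X : topologicalType) (f : X -> X) : eOrd :=
  esup (fun u => exists2 W, unif W & u = beta_W f W setT).

HB.mixin Record Topological_isTopologicalGroup G of Group G & Topological G := {
  mulg_continuous : continuous (fun p : G * G => (p.1 * p.2)%g) ;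
  invg_continuous : continuous (fun g : G => (g^-1)%g)
}.

#[short(type="topologicalGroupType")]
HB.structure Definition TopologicalGroup :=
  {G of Topological_isTopologicalGroup G & Group G & Topological G}.

Section DynamicalSystems.
Variables (G : topologicalGroupType) (X : topologicalType) (act : G -> X -> X).

Definition dynamical_system : Prop :=
  [/\ compact [set: X], hausdorff_space X,
      forall x, act 1%g x = x,
      forall g h x, act (g * h)%g x = act g (act h x) &
      continuous (fun p : G * X => act p.1 p.2)].

Definition ellis : set {ptws X -> X} :=
  closure (range act : set {ptws X -> X}).

Definition beta_sys : eOrd :=
  esup (fun u => exists2 f, ellis f & u = beta_map f).

End DynamicalSystems.

Definition fragmented (X : topologicalType) (f : X -> X) : Prop :=
  forall (D : set X) (W : set (X * X)), closed D -> D !=set0 -> unif W ->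
    exists V : set X, [/\ open V, D `&` V !=set0 &
      forall a b, (D `&` V) a -> (D `&` V) b -> W (f a, f b)].

Definition tame (G : topologicalGroupType) (X : topologicalType)
  (act : G -> X -> X) : Prop := forall f, ellis act f -> fragmented f.

(* Main.v *)
Require Import Defs.
From mathcomp Require Import all_boot.
From mathcomp Require Import all_classical wochoice topology.

(** Unfolding the recursion, the iterated derivative [D^a] of [Y] is the set of
    the points of [Y] lying in the derivative of every earlier [D^c]
    ([deriv_iterP]); monotonicity, closedness and invariance under isomorphism
    of ordinals all follow from this formula.

    If [f] is fragmented, a nonempty closed set strictly contains its
    derivative, and some basic open set witnesses it: it meets [D] but not the
    derivative of [D]. Along the decreasing chain of the [D^a] for one entourage
    [W] these witnesses are pairwise distinct, so the chain has at most [w(X)]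
    nonempty terms. This bounds each [beta(f, W)]. To bound the supremum over
    [W], shrink [W] to a finite union of squares of basic open sets, which
    compactness allows ([unif_squares]). An ordinal [a] with [D^a] nonempty for
    some [W] is then determined by a finite list of basic sets: the witness at
    stage [a] and the squares making up the entourage. If such [a] were cofinal
    in the successor cardinal [w(X)^+], that cardinal would inject into the
    finite lists over [w(X)], hence into [w(X)] when [w(X)] is infinite
    ([infinite_square]), which is absurd. When [w(X)] is finite, the bound for a
    single [W] is already enough. So fragmented maps have
    [beta(f) < w(X)^+] ([fragmented_beta_lt]), and taking the supremum over the
    Ellis semigroup makes [beta(X, G)] an ordinal.

    Conversely, if fragmentation of [f] fails for a closed set [D] and an
    entourage [W], then [D] is contained in its own derivative, hence in every
    [D^a], and [beta(f, W)] is not an ordinal ([beta_finite_fragmented]). *)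

Set Implicit Arguments.
Unset Strict Implicit.
Unset Printing Implicit Defensive.
Local Open Scope classical_set_scope.
Local Open Scope card_scope.

(** * Comparison of cardinals by injections *)
Definition injects (T U : Type) : Prop := exists f : T -> U, injective f.

Lemma injectsP (T U : Type) : [set: T] #<= [set: U] <-> injects T U.
Proof.
split=> [/card_leP[f]|[f finj]].
  exists (fun x => val (f (to_setT x))) => x y /val_inj/(@inj _ _ _ f).
  by move=> /(_ (mem_set I) (mem_set I)) /(congr1 val).
apply/card_leP/injfunPex; exists (fun x => to_setT (f (val x))) => // x y _ _.
by move=> /(congr1 val)/= /finj/val_inj.
Qed.

Lemma injects_trans (T U V : Type) : injects T U -> injects U V -> injects T V.
Proof. by move=> [f fi] [g gi]; exists (g \o f); exact: inj_comp. Qed.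

Lemma injectsX (T U T' U' : Type) :
  injects T U -> injects T' U' -> injects (T * T') (U * U').
Proof.
move=> [f fi] [g gi]; exists (fun p => (f p.1, g p.2)).
by move=> [x x'] [y y'] /= [/fi-> /gi->].
Qed.

Definition infinite (T : Type) : Prop := injects nat T.

Lemma infiniteE (T : Type) : infinite T <-> infinite_set [set: T].
Proof. by rewrite infiniteP injectsP. Qed.

(** Finiteness passes from [T] to [option T] and to squares. *)
Lemma infinite_optionX (T : Type) :
  infinite (option T * option T) -> infinite T.
Proof.
rewrite !infiniteE => + finT; apply.
rewrite -setXTT; have finO : finite_set [set: option T].
  have -> : [set: option T] = [set None] `|` Some @` [set: T].
    by apply/seteqP; split=> [[x|]|] // _; [right; exists x|left].
  by rewrite finite_setU; split; [exact: finite_set1|exact: finite_image].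
exact: finite_setX.
Qed.

(** The orbit of a point that [f] misses is an injective sequence. *)
Lemma infinite_proper_injection (T : Type) (f : T -> T) (z : T) :
  injective f -> (forall x, f x <> z) -> infinite T.
Proof.
move=> fi fz; exists (fun n => iter n f z) => m n.
elim: m n => [|m IH] [|n] //=.
- by move=> /esym/fz.
- by move=> /fz.
- by move=> /fi/IH->.
Qed.

(** Two distinct first coordinates serve as tags for the two constructors; the
    encoding of lists below uses the same tags. *)
Lemma injects_option_of_square (T : Type) :
  infinite T -> injects (T * T) T -> injects (option T) T.
Proof.
move=> [i ii] [j ji].
exists (fun o => if o is Some x then j (i 0, x) else j (i 1, i 0)).
by case=> [x|] [y|] // /ji[]; [move=> ->|move=> /ii|move=> /ii].
Qed.

Lemma injects_seq_of_square (T : Type) :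
  infinite T -> injects (T * T) T -> injects (seq T) T.
Proof.
move=> [i ii] [j ji].
pose e := fix e (s : seq T) := if s is x :: s' then j (i 0, j (x, e s'))
                               else j (i 1, i 0).
exists e; elim=> [|x s IH] [|y t] //= /ji[]; try by move=> /ii.
by move=> /ji[-> /IH->].
Qed.

(** * Constructions of ordinals *)
Lemma well_orderI (T : eqType) (R : rel T) : antisymmetric R ->
  (forall P : T -> Prop, (exists x, P x) ->
     exists x, P x /\ forall y, P y -> R x y) ->
  well_order R.
Proof.
move=> Ranti Rmin A [x Ax].
have [z [Az minz]] := Rmin (fun x => x \in A) (ex_intro _ x Ax).
exists z; split=> [//|y [Ay miny]].
by apply: Ranti; rewrite minz // miny.
Qed.

Section Pullback.
Variables (T : eqType) (a : Ord) (g : T -> a).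
Hypothesis ginj : injective g.

Lemma pullback_wo : well_order (fun x y => ord_le (g x) (g y)).
Proof.
apply: well_orderI => [x y /andP[xy yx]|P [x Px]].
  exact/ginj/ord_le_anti.
have [|_ [[z Pz <-] minz]] := @ord_least _ (g @` P).
  by exists (g x); exists x.
by exists z; split=> // y Py; apply: minz; exists y.
Qed.

Definition pullback : Ord := MkOrd pullback_wo.

End Pullback.

Section Lex.
Variables a b : Ord.

Definition lex_le (p q : a * b) : bool :=
  ord_lt p.1 q.1 || (p.1 == q.1) && ord_le p.2 q.2.

Lemma lex_wo : well_order lex_le.
Proof.
apply: well_orderI => [[x y] [x' y']|P [[x y] Pxy]]; rewrite /lex_le /=.
  rewrite /ord_lt (eq_sym x' x); case: eqVneq => [->|nxx'] /=.
    by rewrite !andbF /= => /andP[? ?]; congr pair; exact: ord_le_anti.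
  rewrite !andbT !orbF => /andP[xx' x'x].
  by rewrite (ord_le_anti xx' x'x) eqxx in nxx'.
have [u [[v Puv] minu]] :=
  ord_least (P := fun u => exists v, P (u, v)) (ex_intro _ x (ex_intro _ y Pxy)).
have [w [Puw minw]] := ord_least (P := fun v => P (u, v)) (ex_intro _ v Puv).
exists (u, w); split=> // -[u' w'] /= Pu'.
rewrite /ord_lt minu /=; last by exists w'.
by case: eqVneq Pu' => //= <- /minw.
Qed.

Definition lex : Ord := MkOrd lex_wo.

End Lex.

Section Segment.
Variables (a : Ord) (z : a).

Definition segment : Ord := pullback (@val_inj _ _ {y : a | ord_lt y z}).

Lemma segment_olt : olt segment a.
Proof.
exists val, z; split=> // y; split=> [yz|[x <-]]; last exact: valP x.
by exists (exist _ y yz).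
Qed.

End Segment.

Lemma olt_segment (a : Ord) (y z : a) :
  ord_lt y z -> olt (segment y) (segment z).
Proof.
move=> yz; have sub (x : segment y) : ord_lt (val x) z.
  exact: ord_lt_le_trans (valP x) (ord_ltW yz).
exists (fun x => exist _ (val x) (sub x)), (exist _ y yz); split=> // x.
split=> [xy|[u <-]]; last exact: valP u.
by exists (exist _ (val x) xy); exact: val_inj.
Qed.

Lemma ole_injects (a b : Ord) : ole a b -> injects a b.
Proof. by move=> [f [fle _]]; exists f; exact: ord_mono_inj. Qed.

(** * Squares of infinite cardinals *)
Section Goedel.
Variable k : Ord.

Definition ordmax (x y : k) : k := if ord_le x y then y else x.

Lemma ordmax_ub x y : ord_le x (ordmax x y) /\ ord_le y (ordmax x y).
Proof.
rewrite /ordmax; have := ord_le_total x y.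
by case: ifP => [->|_ /= ->]; rewrite !ord_lexx.
Qed.

(** Goedel's pairing order compares the larger coordinates first: the pairs
    below a given one then lie in a bounded square, so that they are few. *)
Definition goedel_key (p : k * k) : lex k (lex k k) := (ordmax p.1 p.2, p).

Lemma goedel_key_inj : injective goedel_key. Proof. by move=> p q []. Qed.

Definition goedel : Ord := pullback goedel_key_inj.

Lemma goedel_lt_max (p q : goedel) :
  ord_lt p q -> ord_le (ordmax p.1 p.2) (ordmax q.1 q.2).
Proof.
by move=> /ord_ltW /orP[/ord_ltW//|/andP[/eqP /= -> _]]; exact: ord_lexx.
Qed.

End Goedel.

(** By induction on [k]. If Goedel's order on the square is at most [k] there is
    nothing to do. Otherwise [k] embeds in a proper segment of it, hence in the
    square of some [{x | x <= m}]. By induction that square injects into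
    [{x | x < m}]; thus [k] itself injects into this smaller infinite ordinal,
    and its square is absorbed there. *)
Lemma infinite_square (k : Ord) : infinite k -> injects (k * k) k.
Proof.
elim/(well_founded_ind olt_wf): k => k IH kinf.
have IHs (z : k) : injects k (option (segment z) * option (segment z)) ->
    injects k (segment z) /\ injects (segment z * segment z) (segment z).
  move=> ks; have sinf := infinite_optionX (injects_trans kinf ks).
  have sq := IH _ (segment_olt z) sinf; split=> //.
  have os := injects_option_of_square sinf sq.
  by apply: injects_trans ks (injects_trans (injectsX os os) sq).
have [/ole_injects//|[f [p [fle fi]]]] := ole_total (goedel k) k.
pose m := ordmax p.1 p.2.
have fm x : ord_le (f x).1 m /\ ord_le (f x).2 m.
  have /goedel_lt_max fpm : ord_lt (f x) p by apply/fi; exists x.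
  have [l r] := ordmax_ub (f x).1 (f x).2.
  by split; apply: ord_le_trans fpm.
(* [{x | x <= m}] is [{x | x < m}] with one more point, encoded by [None]. *)
pose c (x : k) : option (segment m) := insub x.
have cinj x y : ord_le x m -> ord_le y m -> c x = c y -> x = y.
  rewrite /c => xm ym; case: insubP => [u _ <-|mx]; case: insubP => [v _ <-|my] //.
    by move=> [->].
  have eqm w : ord_le w m -> ~~ ord_lt w m -> w = m.
    by move=> wm; rewrite ord_ltNge negbK => /(ord_le_anti wm).
  by move=> _; rewrite (eqm _ xm mx) (eqm _ ym my).
have [ks ss] : injects k (segment m) /\
    injects (segment m * segment m) (segment m).
  apply: IHs; exists (fun x => (c (f x).1, c (f x).2)) => x y [e1 e2].
  apply: (ord_mono_inj fle); have [? ?] := fm x; have [? ?] := fm y.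
  by rewrite [f x]surjective_pairing [f y]surjective_pairing; congr pair; exact: cinj.
apply: injects_trans (injectsX ks ks) (injects_trans ss _).
exact/ole_injects/oltW/segment_olt.
Qed.

(** * Iterated derivatives *)
Section Derivatives.
Variable X : topologicalType.
Implicit Types (f : X -> X) (W : set (X * X)) (Y D : set X) (a c : Ord).

Lemma deriv_sub f W Y : deriv f W Y `<=` Y.
Proof. by move=> y []. Qed.

Lemma deriv_mono f W W' Y Y' :
  Y `<=` Y' -> W' `<=` W -> deriv f W Y `<=` deriv f W' Y'.
Proof.
move=> YY' W'W y [/YY' Yy Oy]; split=> // O oO /(Oy O oO)[v1 [v2 [[? ?] [? ?] nW]]].
by exists v1, v2; split; [split=> //; exact: YY'..|move/W'W].
Qed.

Lemma deriv_closed f W Y : closed Y -> closed (deriv f W Y).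
Proof.
move=> cY y cly; split.
  by apply: cY => O /cly[z [/deriv_sub ? ?]]; exists z.
move=> O oO Oy.
have [z [[_ zO] /zO]] := cly O (open_nbhs_nbhs (conj oO Oy)).
exact.
Qed.

(** One formula covers the zero, successor and limit stages. For a limit [a],
    the stage [c < a] has some [d] strictly between [c] and [a], and the
    induction hypothesis at [d] gives membership in the derivative at [c]. *)
Lemma deriv_iterP f W Y a : deriv_iter f W Y a =
  [set y | Y y /\ forall c, olt c a -> deriv f W (deriv_iter f W Y c) y].
Proof.
apply/seteqP; split=> y; last first.
  move=> [Yy Dy]; rewrite deriv_iterE; split=> // [c ca _|_ c /Dy/deriv_sub//].
  exact: Dy.
elim/(well_founded_ind olt_wf): a y => a IH y.
have IHle c d : olt d a -> ole c d -> deriv_iter f W Y d `<=` deriv_iter f W Y c.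
  move=> da cd z /(IH d da)[Yz Dz]; rewrite deriv_iterE.
  have Dz' e : olt e c -> deriv f W (deriv_iter f W Y e) z.
    by move=> ec; apply: Dz; exact: olt_ole_trans cd.
  by split=> // [e ec _|_ e /Dz'/deriv_sub//]; exact: Dz'.
have [a0|na0] := pselect (is_zero a).
  by rewrite deriv_iter0 // => Yy; split=> // c /a0.
have [[d [da dmax]]|nsucc] := pselect (exists d, is_succ d a).
  rewrite (deriv_iter_succ _ _ _ (conj da dmax)) => Dy; split.
    by have [] := IH d da y (deriv_sub Dy).
  by move=> c ca; apply: deriv_mono Dy => //; apply: IHle => //; exact: dmax.
have lim : is_limit a by split=> // c ac; apply: nsucc; exists c.
rewrite deriv_iter_limit // => Dy; split.
  have [c ca] : exists c, olt c a.
    by apply: contrapT => nc; apply: na0 => c ca; apply: nc; exists c.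
  by have [] := IH c ca y (Dy c ca).
move=> c ca; have [d [da cd]] : exists d, olt d a /\ olt c d.
  apply: contrapT => nd; apply: nsucc; exists c; split=> // d da.
  by have [//|cd] := ole_total d c; case: nd; exists d.
exact: (IH d da y (Dy d da)).2.
Qed.

Lemma deriv_iter_lt f W Y a c :
  olt c a -> deriv_iter f W Y a `<=` deriv f W (deriv_iter f W Y c).
Proof. by move=> ca y; rewrite deriv_iterP => -[_]; exact. Qed.

Lemma deriv_iter_le f W Y a c :
  ole c a -> deriv_iter f W Y a `<=` deriv_iter f W Y c.
Proof.
move=> ca y; rewrite !(deriv_iterP _ _ _ _) => -[Yy Dy]; split=> // d dc.
by apply: Dy; exact: olt_ole_trans ca.
Qed.

Lemma deriv_iter_mono f W W' Y a :
  W' `<=` W -> deriv_iter f W Y a `<=` deriv_iter f W' Y a.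
Proof.
move=> W'W; elim/(well_founded_ind olt_wf): a => a IH y.
rewrite !(deriv_iterP _ _ _ a) => -[Yy Dy]; split=> // c ca.
by apply: deriv_mono (Dy c ca) => //; exact: IH.
Qed.

Lemma deriv_iter_closed f W Y a : closed Y -> closed (deriv_iter f W Y a).
Proof.
move=> cY; elim/(well_founded_ind olt_wf): a => a IH.
rewrite deriv_iterP => y cly; split.
  by apply: cY => O /cly[z [[? _] ?]]; exists z.
move=> c ca; apply: (deriv_closed (IH c ca)) => O /cly[z [[_ Dz] Oz]].
by exists z; split=> //; exact: Dz.
Qed.

(** A set without [W]-small relatively open pieces survives every stage. *)
Lemma deriv_iter_perfect f W Y D a :
  D `<=` Y -> D `<=` deriv f W D -> D `<=` deriv_iter f W Y a.
Proof.
move=> DY DD; elim/(well_founded_ind olt_wf): a => a IH y Dy.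
rewrite deriv_iterP; split; first exact: DY.
by move=> c ca; apply: (deriv_mono (IH c ca) (@subset_refl _ W)); exact: DD.
Qed.

End Derivatives.

(** * Suprema and successor cardinals *)
Lemma esup_le (S : eOrd -> Prop) (b : Ord) :
  (forall u, S u -> eole u (EFin b)) -> eole (esup S) (EFin b).
Proof.
move=> Sb; rewrite /esup; case: pselect => [e|[]]; last by exists b.
exact: (ordminP e).2.
Qed.

Lemma esup_ub (S : eOrd -> Prop) (b : Ord) :
  esup S = EFin b -> forall u, S u -> eole u (EFin b).
Proof.
rewrite /esup; case: pselect => // e [<-].
exact: (ordminP e).1.
Qed.

Lemma ole_olt_trans (a b c : Ord) : ole a b -> olt b c -> olt a c.
Proof.
move=> ab bc; have [ca|//] := ole_total c a.
by case: (@olt_irrefl b); exact: olt_ole_trans bc (ole_trans ca ab).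
Qed.

Lemma card_succ_gt (k l : Ord) : injects l k -> olt l (card_succ k).
Proof.
move=> lk; have [kl|//] := ole_total (card_succ k) l.
case: (card_succP k) => /injectsP[]; exact: injects_trans (ole_injects kl) lk.
Qed.

Lemma card_succ_not_injects (k : Ord) : ~ injects (card_succ k) k.
Proof. by move=> /injectsP; exact: (card_succP k).1. Qed.

Lemma olt_injects_infinite (k l : Ord) : olt k l -> injects l k -> infinite k.
Proof.
move=> [f [z [fle fi]]] [g ginj].
apply: (@infinite_proper_injection _ (g \o f) (g z)) => [|x /= /ginj fxz].
  exact/inj_comp/ord_mono_inj.
by have := (fi (f x)).2 (ex_intro _ x erefl); rewrite fxz ord_ltxx.
Qed.

(** * Ranks of fragmented maps *)
Section Fragmented.
Variables (X : topologicalType) (k : Ord) (e : k -> set X).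
Hypothesis e_basis : basis (range e).

Lemma basis_nbhs x A : nbhs x A -> exists i, e i x /\ e i `<=` A.
Proof. by move=> /(e_basis.2 x)[U [[i _ <-] ix] iA]; exists i. Qed.

Definition squares (s : seq k) : set (X * X) :=
  [set p | exists2 i, i \in s & e i p.1 /\ e i p.2].

(** The finite unions of squares of basic open sets form a base of the
    uniformity, by compactness of the diagonal. *)
Lemma unif_squares (W : set (X * X)) : compact [set: X] -> unif W ->
  exists s, unif (squares s) /\ squares s `<=` W.
Proof.
move=> cX uW.
have small x : exists i, e i x /\ forall y z, e i y -> e i z -> W (y, z).
  have [[A B] /= [Ax Bx] ABW] : nbhs (x, x) W by exact: uW.
  have [i [ix iAB]] := basis_nbhs (filterI Ax Bx).
  by exists i; split=> // y z /iAB[Ay _] /iAB[_ Bz]; exact: ABW.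
have [c cP] := choice small.
(* [F] is the filter of properties that hold for all sufficiently large finite
   lists of points; the near-covering form of compactness along [F] provides a
   list whose neighbourhoods [e (c y)] cover [X]. *)
pose F : set_system (seq X) := 
    filter_from [set: seq X] (fun s => [set t | {subset s <= t}]).
have FF : Filter F.
  apply: filter_from_filter; first by exists [::].
  move=> s t _ _; exists (s ++ t) => // r str; split=> x xs; apply: str.
    by rewrite mem_cat xs.
  by rewrite mem_cat xs orbT.
pose covers (s : seq X) x := exists2 y, y \in s & e (c y) x.
have [|s _ /(_ s)/(_ (fun _ => id)) DX] :=
    (compact_near_coveringP [set: X]).1 cX _ F covers FF.
  move=> x _; exists (e (c x), [set t | {subset [:: x] <= t}]) => /=.
    split; last by exists [:: x].
    apply: open_nbhs_nbhs; split; last exact: (cP x).1.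
    by apply: e_basis.1; exists (c x).
  by move=> [y t] /= [cxy xt]; exists x => //; apply: xt; rewrite mem_head.
exists (map c s); split=> [[x y] /= xy|[y z] [_ /mapP[x _ ->] [/= ? ?]]].
  have [z zs zx] := DX x I.
  have nx : nbhs x (e (c z)).
    by apply: open_nbhs_nbhs; split=> //; apply: e_basis.1; exists (c z).
  rewrite -(xy : x = y); exists (e (c z), e (c z)) => // q [/= q1 q2].
  by exists (c z) => //; exact: map_f.
exact: (cP x).2.
Qed.

Variable f : X -> X.
Hypothesis f_fragmented : fragmented f.

Lemma fragmented_deriv W D : closed D -> D !=set0 -> unif W ->
  exists i, (e i `&` D) !=set0 /\ e i `&` deriv f W D = set0.
Proof.
move=> cD D0 uW; have [V [oV [x [Dx Vx]] VW]] := f_fragmented cD D0 uW.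
have [i [ix iV]] := basis_nbhs (open_nbhs_nbhs (conj oV Vx)).
exists i; split; first by exists x.
apply/seteqP; split=> // y [iy [Dy /(_ (e i))]].
case=> //; first by apply: e_basis.1; exists i.
move=> v1 [v2 [[? ?] [? ?] []]]; apply: VW; split=> //; exact: iV.
Qed.

(** If [y < z] used the same entourage and the same witness, this witness would
    miss the derivative at stage [y] and meet the smaller stage [z]. Letting [W]
    vary with the stage makes it possible to treat all entourages together. *)
Lemma fragmented_rank_code (l : Ord) (W : l -> set (X * X)) :
  (forall z, unif (W z)) ->
  (forall z, deriv_iter f (W z) setT (segment z) !=set0) ->
  exists u : l -> k, forall y z, W y = W z -> u y = u z -> y = z.
Proof.
move=> uW W0.
have [u uP] := choice (fun z : l => fragmented_deriv
  (@deriv_iter_closed _ f (W z) _ (segment z) closedT) (W0 z) (uW z)).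
exists u.
have lt y z : W y = W z -> u y = u z -> ~ ord_lt y z.
  move=> Wyz uyz /olt_segment yz.
  have [x [ix Dx]] := (uP z).1.
  suff : set0 x by [].
  rewrite -(uP y).2 uyz; split=> //; rewrite Wyz.
  exact: deriv_iter_lt yz _ Dx.
move=> y z Wyz uyz; apply: ord_le_anti; rewrite -[_ _ _]negbK -ord_ltNge; apply/negP.
- exact: lt.
- exact: lt.
Qed.

Lemma fragmented_rank_injects W a : unif W ->
  deriv_iter f W setT a !=set0 -> injects a k.
Proof.
move=> uW [x Dx].
have [|z|u uP] := @fragmented_rank_code a (fun=> W); first by [].
  by exists x; apply: deriv_iter_le Dx; exact/oltW/segment_olt.
by exists u => y z; exact: uP.
Qed.

(** For finite [k], an ordinal above [k] cannot inject into [k], so [k] bounds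
    all ranks. For infinite [k], some proper segment of [card_succ k] is a
    bound; otherwise every [z] in [card_succ k] is coded by the list
    [u z :: s z] of a witness and an entourage. *)
Lemma fragmented_rank_bound : compact [set: X] ->
  exists2 b, olt b (card_succ k) & forall W a, unif W ->
    deriv_iter f W setT a !=set0 -> ole a b.
Proof.
move=> cX; have [kinf|kfin] := pselect (infinite k); last first.
  exists k; first by apply: card_succ_gt; exists id.
  move=> W a uW /(fragmented_rank_injects uW) ak.
  by have [//|/olt_injects_infinite/(_ ak)] := ole_total a k.
apply: contrapT => nb.
have ex (z : card_succ k) : exists s, unif (squares s) /\
    deriv_iter f (squares s) setT (segment z) !=set0.
  apply: contrapT => ns; apply: nb; exists (segment z); first exact: segment_olt.
  move=> W a uW [x Dx]; have [//|za] := ole_total a (segment z).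
  have [s [us sW]] := unif_squares cX uW.
  case: ns; exists s; split=> //; exists x.
  exact/(deriv_iter_mono sW)/(deriv_iter_le (oltW za)).
have [s sP] := choice ex.
have [||u uP] := @fragmented_rank_code _ (squares \o s).
- by move=> z; exact: (sP z).1.
- by move=> z; exact: (sP z).2.
apply: (@card_succ_not_injects k).
apply: injects_trans (injects_seq_of_square kinf (infinite_square kinf)).
by exists (fun z => u z :: s z) => y z [uyz syz]; apply: uP => //=; rewrite syz.
Qed.

End Fragmented.

Lemma weight_basis (X : topologicalType) :
  exists e : weight X -> set X, basis (range e).
Proof.
have [[B bB /pcard_eqP[e]] _] := weightP X.
exists e; suff -> : range e = B by [].
exact: image_eq.
Qed.

Lemma fragmented_beta_lt (X : topologicalType) (f : X -> X) :
  compact [set: X] -> fragmented f ->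
  eolt (beta_map f) (EFin (card_succ (weight X))).
Proof.
move=> cX frag; have [e eB] := weight_basis X.
have [b blt bub] := fragmented_rank_bound eB frag cX.
have : eole (beta_map f) (EFin b).
  apply: esup_le => _ [W uW ->]; apply: esup_le => _ [a -> Da]; exact: bub Da.
case: (beta_map f) => //= c cb.
exact: ole_olt_trans cb blt.
Qed.

(** An ordinal rank cannot dominate its own successor cardinal, while a set on
    which fragmentation fails meets every stage. *)
Lemma beta_finite_fragmented (X : topologicalType) (f : X -> X) (b : Ord) :
  beta_map f = EFin b -> fragmented f.
Proof.
move=> fb D W cD [x Dx] uW; apply: contrapT => nV.
have perfect : D `<=` deriv f W D.
  move=> y Dy; split=> // O oO Oy; apply: contrapT => nv; apply: nV.
  exists O; split=> //; first by exists y.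
  move=> u v [Du Ou] [Dv Ov]; apply: contrapT => nW.
  by apply: nv; exists u, v.
have := esup_ub fb (ex_intro2 _ _ W uW erefl).
case bW : (beta_W f W setT) => [c|//] _.
have : ole (card_succ c) c.
  apply: (esup_ub bW (u := EFin _)); exists (card_succ c) => //.
  by exists x; exact: (@deriv_iter_perfect _ _ _ _ D).
by move=> /ole_injects/card_succ_not_injects.
Qed.

Theorem corollary4p6 (G : topologicalGroupType) (X : topologicalType)
    (act : G -> X -> X) (sysXG : dynamical_system act) :
  [<-> tame act;
       eolt (beta_sys act) EInf;
       forall f : X -> X, ellis act f ->
         eolt (beta_map f) (EFin (card_succ (weight X)))].
Proof.
have cX : compact [set: X] by case: sysXG.
have lt_of_tame : tame act -> forall f : X -> X, ellis act f ->
    eolt (beta_map f) (EFin (card_succ (weight X))).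
  by move=> tm f /tm; exact: fragmented_beta_lt.
tfae.
- move=> /lt_of_tame lt.
  have : eole (beta_sys act) (EFin (card_succ (weight X))).
    apply: esup_le => _ [f /lt + ->]; case: (beta_map f) => //= a.
    exact: oltW.
  by case: (beta_sys act).
- move=> fin; apply: lt_of_tame => f Ef.
  case bs : (beta_sys act) fin => [b|//] _.
  have := esup_ub bs (ex_intro2 _ _ f Ef erefl).
  case bf : (beta_map f) => [c|//] _; exact: beta_finite_fragmented bf.
- move=> lt f /lt; case bf : (beta_map f) => [c|//] _.
  exact: beta_finite_fragmented bf.
Qed.
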